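(* Let $G_n=\overline{C_n}$ for $n\ge 3$ be the graph complement of the cycle graph with $n$ vertices, and let $G_2$ be the graph with two vertices and no edges. Then for every integer $d\ge 0$, the graph $G_{3d+3}$ is homotopic to a wedge sum of two $d$-spheres, while $G_{3d+2}$ and $G_{3d+4}$ are both homotopic to $d$-spheres.
   Context: All graphs are finite and simple. The unit sphere $S(x)$ of a vertex $x$ is the subgraph induced by the neighbors of $x$. A graph is contractible if it is the one-point graph $K_1$ or (inductively) if it has a vertex $x$ such that both $S(x)$ and the graph $G-x$ with $x$ removed are contractible. A homotopy extension of $G$ adds a new vertex joined exactly to the vertices of a contractible induced subgraph $A$ of $G$; a homotopy reduction is the reverse (removing a vertex $x$ with $S(x)$ contractible). Two graphs are homotopic if one is obtained from the other by finitely many homotopy extensions and reductions. Spheres are defined inductively: the empty graph is the $(-1)$-sphere, and for $d\ge 0$ a $d$-sphere is a graph all of whose unit spheres are $(d-1)$-spheres and which becomes contractible after removing some vertex. A wedge sum of two graphs is obtained from their disjoint union by identifying one vertex of the first with one vertex of the second. *)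

(* Defs.v *)
From mathcomp Require Import all_boot.

Set Implicit Arguments.
Unset Strict Implicit.
Unset Printing Implicit Defensive.

Record sgraph := SGraph {
  vertex :> finType;
  edge : rel vertex;
  edge_sym : symmetric edge;
  edge_irr : irreflexive edge }.

Definition graph_iso (G H : sgraph) : Prop :=
  exists2 f : G -> H, bijective f & forall x y, edge (f x) (f y) = edge x y.

Section InducedSubgraph.
Variables (G : sgraph) (A : {set G}).

Definition induced_edge : rel {x : G | x \in A} :=
  fun x y => edge (val x) (val y).

Fact induced_edge_sym : symmetric induced_edge.
Proof. by move=> x y; apply: edge_sym. Qed.

Fact induced_edge_irr : irreflexive induced_edge.
Proof. by move=> x; apply: edge_irr. Qed.

Definition induced : sgraph := SGraph induced_edge_sym induced_edge_irr.
End InducedSubgraph.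

Definition unit_sphere (G : sgraph) (x : G) : sgraph :=
  induced [set y | edge x y].

Definition delete_vertex (G : sgraph) (x : G) : sgraph := induced [set~ x].

Inductive contractible : sgraph -> Prop :=
| contractible_K1 (G : sgraph) : #|G| = 1 -> contractible G
| contractible_step (G : sgraph) (x : G) :
    contractible (unit_sphere x) -> contractible (delete_vertex x) ->
    contractible G.

Section AddVertex.
Variables (G : sgraph) (A : {set G}).

(* [None] is the new vertex. *)
Definition add_vertex_edge : rel (option G) := fun u v =>
  match u, v with
  | Some x, Some y => edge x y
  | Some x, None | None, Some x => x \in A
  | None, None => false
  end.

Fact add_vertex_edge_sym : symmetric add_vertex_edge.
Proof. by move=> [x|] [y|] //=; apply: edge_sym. Qed.

Fact add_vertex_edge_irr : irreflexive add_vertex_edge.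
Proof. by move=> [x|] //=; apply: edge_irr. Qed.

Definition add_vertex : sgraph :=
  SGraph add_vertex_edge_sym add_vertex_edge_irr.
End AddVertex.

(* Graphs are taken up to isomorphism, hence [homotopic_iso]. *)
Inductive homotopic (G : sgraph) : sgraph -> Prop :=
| homotopic_refl : homotopic G G
| homotopic_iso (H K : sgraph) :
    homotopic G H -> graph_iso H K -> homotopic G K
| homotopic_extension (H : sgraph) (A : {set H}) :
    homotopic G H -> contractible (induced A) -> homotopic G (add_vertex A)
| homotopic_reduction (H : sgraph) (x : H) :
    homotopic G H -> contractible (unit_sphere x) ->
    homotopic G (delete_vertex x).

(* The dimension is shifted so as to start at -1: [sphere_pred k G] says that
   G is a (k-1)-sphere. *)
Fixpoint sphere_pred (k : nat) (G : sgraph) : Prop :=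
  if k is k'.+1 then
    (forall x : G, sphere_pred k' (unit_sphere x)) /\
    (exists x : G, contractible (delete_vertex x))
  else #|G| = 0.

Definition is_sphere (d : nat) (G : sgraph) : Prop := sphere_pred d.+1 G.

Section Wedge.
Variables (G H : sgraph) (a : G) (b : H).

(* The vertex b of H is identified with the vertex a of G, and the class {a, b}
   is represented by [inl a]. *)
Definition wedge_edge : rel (G + {y : H | y != b}) := fun u v =>
  match u, v with
  | inl x, inl y => edge x y
  | inr x, inr y => edge (val x) (val y)
  | inl x, inr y | inr y, inl x => (x == a) && edge b (val y)
  end.

Fact wedge_edge_sym : symmetric wedge_edge.
Proof. by move=> [x|x] [y|y] //=; apply: edge_sym. Qed.

Fact wedge_edge_irr : irreflexive wedge_edge.
Proof. by move=> [x|x] //=; apply: edge_irr. Qed.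

Definition wedge : sgraph := SGraph wedge_edge_sym wedge_edge_irr.
End Wedge.

Section Complement.
Variable G : sgraph.

Definition complement_edge : rel G := fun x y => (x != y) && ~~ edge x y.

Fact complement_edge_sym : symmetric complement_edge.
Proof. by move=> x y; rewrite /complement_edge eq_sym edge_sym. Qed.

Fact complement_edge_irr : irreflexive complement_edge.
Proof. by move=> x; rewrite /complement_edge eqxx. Qed.

Definition complement : sgraph := SGraph complement_edge_sym complement_edge_irr.
End Complement.

Section Cycle.
Variable n : nat.

(* [ordS] is the successor modulo n.  This is the cycle graph C_n for n >= 3;
   the condition [i != j] matters only for n = 1. *)
Definition cycle_edge : rel 'I_n := fun i j =>
  (i != j) && ((j == ordS i) || (i == ordS j)).

Fact cycle_edge_sym : symmetric cycle_edge.
Proof. by move=> i j; rewrite /cycle_edge eq_sym orbC. Qed.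

Fact cycle_edge_irr : irreflexive cycle_edge.
Proof. by move=> i; rewrite /cycle_edge eqxx. Qed.

Definition cycle_graph : sgraph := SGraph cycle_edge_sym cycle_edge_irr.
End Cycle.

Definition edgeless_graph (n : nat) : sgraph :=
  @SGraph 'I_n (fun _ _ => false) (fun _ _ => erefl) (fun _ => erefl).

(* Meaningful for n >= 2 only. *)
Definition cocycle_graph (n : nat) : sgraph :=
  if n == 2 then edgeless_graph 2 else complement (cycle_graph n).

(* Main.v *)
Require Import Defs.
From mathcomp Require Import all_boot zify.

(** In terms of clique complexes, the complement of C_n gives the independence
    complex of C_n.  The theorem is a consequence of the fact that lengthening a
    cycle by three edges suspends its independence complex.

    [cocycle_add3] proves this fact by three moves: one vertex extension and two
    reductions turn the complement of C_(n+3) into the suspension of the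
    complement of C_n, where the suspension of a graph is its join with two
    non-adjacent poles.  Since suspension preserves homotopy [susp_homotopic]
    and raises the dimension of spheres by one [susp_sphere_pred], it remains to
    treat n = 2, 3, 4 and to suspend d times.  For n = 2 the graph is the
    0-sphere; for n = 4 it consists of two disjoint edges and retracts to the
    case n = 2; for n = 3 it is edgeless on three vertices, which is a wedge of
    two 0-spheres.

    For n = 3 the iterated suspension of a wedge has to be turned into a wedge
    of iterated suspensions: [susp_wedge] shows that the suspension of a wedge
    is homotopic to the wedge of the suspensions, by splitting each pole into two
    poles, one for each side.

    The unit spheres that occur in these moves are contractible because a cone
    is contractible [cone_contractible], and because a vertex v dominated by an
    adjacent vertex u, that is one whose neighbours are all equal or adjacent to
    u, can be removed [dominated_contractible].  To avoid iterated constructions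
    on vertex types, moves are made between induced subgraphs of one ambient
    graph that contains all the vertices involved
    [induced_reduction], [induced_extension]. *)

Set Implicit Arguments.
Unset Strict Implicit.
Unset Printing Implicit Defensive.

(** * Isomorphisms and induced subgraphs *)

Lemma graph_iso_refl (G : sgraph) : graph_iso G G.
Proof. by exists id => //; exists id. Qed.

Lemma graph_iso_sym (G H : sgraph) : graph_iso G H -> graph_iso H G.
Proof.
case=> f [g fK gK] fE; exists g; first by exists f.
by move=> x y; rewrite -fE !gK.
Qed.

Lemma graph_iso_trans (G H K : sgraph) :
  graph_iso G H -> graph_iso H K -> graph_iso G K.
Proof.
case=> f fB fE [g gB gE]; exists (g \o f); first exact: bij_comp.
by move=> x y; rewrite /= gE fE.
Qed.

(** This is how the graphs built by suspension, wedge and vertex extension are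
    compared with subgraphs of an ambient graph. *)
Lemma embedding_iso (H G : sgraph) (f : H -> G) (A : {set G}) :
  injective f -> (forall x y, edge (f x) (f y) = edge x y) ->
  (forall x, f x \in A) -> (forall y, y \in A -> exists x, f x = y) ->
  graph_iso H (induced A).
Proof.
move=> f_inj fE fA Af.
exists (fun x => exist (fun y => y \in A) (f x) (fA x)); last exact: fE.
apply: inj_card_bij => [x y [] /f_inj //|].
rewrite card_sig -(card_codom f_inj); apply/subset_leq_card/subsetP => y.
by case/Af=> x <-; apply: codom_f.
Qed.

Lemma induced_embedding (H G : sgraph) (f : H -> G) (B : {set H})
    (A : {set G}) :
  injective f -> (forall x y, edge (f x) (f y) = edge x y) ->
  (forall x, (f x \in A) = (x \in B)) ->
  (forall y, y \in A -> exists x, f x = y) ->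
  graph_iso (induced B) (induced A).
Proof.
move=> f_inj fE fA Af.
apply: (@embedding_iso (induced B) G (fun x => f (val x))) => //=.
- exact: inj_comp val_inj.
- by move=> [x xB] /=; rewrite fA.
- move=> y yA; have [x fx] := Af y yA.
  have xB : x \in B by rewrite -fA fx.
  by exists (exist _ x xB).
Qed.

Lemma iso_induced (G H : sgraph) (f : G -> H) (A : {set G}) (B : {set H}) :
  bijective f -> (forall x y, edge (f x) (f y) = edge x y) ->
  (forall x, (f x \in B) = (x \in A)) -> graph_iso (induced A) (induced B).
Proof.
move=> fB fE fA; apply: (induced_embedding _ fE fA); first exact: bij_inj.
by case: fB => g _ gK y _; exists (g y).
Qed.

Lemma induced_induced (G : sgraph) (A C : {set G}) (B : {set induced A}) :
  C \subset A -> (forall x, (val x \in C) = (x \in B)) ->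
  graph_iso (induced B) (induced C).
Proof.
move=> sCA BC; apply: (@induced_embedding (induced A) G (fun x => val x)) => //.
  exact: val_inj.
by move=> y yC; exists (exist _ y (subsetP sCA _ yC)).
Qed.

Lemma induced_setT (G : sgraph) : graph_iso G (induced [set: G]).
Proof.
by apply: (@embedding_iso _ _ id) => //= y _; exists y.
Qed.

Lemma edgeless_iso (G H : sgraph) :
  (forall x y : G, edge x y = false) -> (forall x y : H, edge x y = false) ->
  #|G| = #|H| -> graph_iso G H.
Proof.
move=> G0 H0 GH.
exists (fun x => enum_val (cast_ord GH (enum_rank x))); last first.
  by move=> x y; rewrite G0 H0.
exists (fun x => enum_val (cast_ord (esym GH) (enum_rank x))) => x.
  by rewrite enum_valK cast_ordK enum_rankK.
by rewrite enum_valK cast_ordKV enum_rankK.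
Qed.

Lemma unit_sphere_iso (G H : sgraph) (f : G -> H) (x : G) :
  bijective f -> (forall x y, edge (f x) (f y) = edge x y) ->
  graph_iso (unit_sphere x) (unit_sphere (f x)).
Proof. by move=> fB fE; apply: (iso_induced fB fE) => y; rewrite !inE fE. Qed.

Lemma delete_vertex_iso (G H : sgraph) (f : G -> H) (x : G) :
  bijective f -> (forall x y, edge (f x) (f y) = edge x y) ->
  graph_iso (delete_vertex x) (delete_vertex (f x)).
Proof.
move=> fB fE; apply: (iso_induced fB fE) => y.
by rewrite !inE (inj_eq (bij_inj fB)).
Qed.

(** * Contractibility and homotopy inside an ambient graph *)

Lemma contractible_iso (G H : sgraph) :
  contractible G -> graph_iso G H -> contractible H.
Proof.
move=> cG; elim: cG H => {G} [G G1|G x _ IHs _ IHd] H [f fB fE].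
  by apply: contractible_K1; rewrite -(bij_eq_card fB).
apply: (@contractible_step _ (f x)).
  exact/IHs/unit_sphere_iso.
exact/IHd/delete_vertex_iso.
Qed.

Lemma induced_contractible_step (G : sgraph) (A : {set G}) (x : G) :
  x \in A -> contractible (induced (A :&: [set y | edge x y])) ->
  contractible (induced (A :\ x)) -> contractible (induced A).
Proof.
move=> xA cS cD; apply: (@contractible_step _ (exist _ x xA : induced A)).
- apply: contractible_iso cS _; apply: graph_iso_sym.
  apply: induced_induced; first exact: subsetIl.
  by move=> y; rewrite !inE (valP y).
- apply: contractible_iso cD _; apply: graph_iso_sym.
  apply: induced_induced; first exact: subD1set.
  by move=> y; rewrite !inE (valP y) andbT -val_eqE.
Qed.

(** Any vertex other than the apex can be removed first, because its unit
    sphere is a smaller cone over the same apex. *)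
Lemma cone_contractible (G : sgraph) (u : G) (A : {set G}) :
  u \in A -> (forall y, y \in A -> y != u -> edge u y) ->
  contractible (induced A).
Proof.
have [n] := ubnP #|A|; elim: n A => // n IHn A leAn uA uE.
have [A1|] := eqVneq (A :\ u) set0.
  apply: contractible_K1; rewrite card_sig.
  by rewrite -[LHS]/#|A| (cardsD1 u) A1 cards0 uA.
case/set0Pn=> v; rewrite !inE => /andP[vu vA].
have uv : edge u v by apply: uE.
have ltAn (B : {set G}) : B \subset A -> v \notin B -> #|B| < n.
  move=> sBA vB; rewrite -ltnS; apply: leq_trans leAn; rewrite ltnS.
  by apply: proper_card; apply/properP; split=> //; exists v.
apply: (@induced_contractible_step _ _ v) => //.
- apply: IHn; first by apply: ltAn; rewrite ?subsetIl // !inE edge_irr andbF.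
    by rewrite !inE uA edge_sym.
  by move=> y; rewrite !inE => /andP[yA _]; apply: uE.
- apply: IHn; first by apply: ltAn; rewrite ?subD1set // !inE eqxx.
    by rewrite !inE uA eq_sym vu.
  by move=> y; rewrite !inE => /andP[_ yA]; apply: uE.
Qed.

(** A vertex v is dominated by u when u is adjacent to v and to all other
    neighbours of v; then the unit sphere of v is a cone with apex u, so that v
    may be removed.  Domination survives the removal of other vertices, hence
    a whole set dominated by u can be removed. *)
Lemma dominated_contractible (G : sgraph) (u : G) (D A : {set G}) :
  u \in A -> u \notin D -> {in D, forall v, edge u v} ->
  {in D & A, forall v w, edge v w -> w != u -> edge u w} ->
  contractible (induced (A :\: D)) -> contractible (induced A).
Proof.
have [n] := ubnP #|A|; elim: n A => // n IHn A leAn uA uD Du Dw cAD.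
have [AD0|] := eqVneq (A :&: D) set0.
  by move: cAD; rewrite -{2}(setID A D) AD0 set0U.
case/set0Pn=> v; rewrite inE => /andP[vA vD].
apply: (@induced_contractible_step _ _ v) => //.
- apply: (@cone_contractible _ u); first by rewrite !inE uA edge_sym Du.
  by move=> y; rewrite !inE => /andP[yA vy]; apply: (Dw v).
- apply: IHn => //.
  + by move: leAn; rewrite (cardsD1 v A) vA.
  + by rewrite !inE uA andbT; apply: contraNneq uD => ->.
  + by move=> x y xD; rewrite !inE => /andP[_ yA]; apply: Dw.
  + suff -> : A :\ v :\: D = A :\: D by [].
    apply/setP => y; rewrite !inE.
    by case: eqVneq => [->|]; rewrite ?vD.
Qed.

Lemma homotopic_trans (G H K : sgraph) :
  homotopic G H -> homotopic H K -> homotopic G K.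
Proof.
move=> GH; elim=> {K} // [K L _ GK KL|K A _ GK|K x _ GK].
- exact: homotopic_iso GK KL.
- exact: homotopic_extension.
- exact: homotopic_reduction.
Qed.

Lemma iso_homotopic (G H : sgraph) : graph_iso G H -> homotopic G H.
Proof. exact/homotopic_iso/homotopic_refl. Qed.

Lemma induced_reduction (G : sgraph) (A : {set G}) (x : G) :
  x \in A -> contractible (induced (A :&: [set y | edge x y])) ->
  homotopic (induced A) (induced (A :\ x)).
Proof.
move=> xA cS.
apply: (@homotopic_iso _ (delete_vertex (exist _ x xA : induced A))).
  apply: homotopic_reduction; first exact: homotopic_refl.
  apply: contractible_iso cS _; apply: graph_iso_sym.
  apply: induced_induced; first exact: subsetIl.
  by move=> y; rewrite !inE (valP y).
apply: induced_induced; first exact: subD1set.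
by move=> y; rewrite !inE (valP y) andbT -val_eqE.
Qed.

Lemma induced_extension (G : sgraph) (A : {set G}) (x : G) :
  x \notin A -> contractible (induced (A :&: [set y | edge x y])) ->
  homotopic (induced A) (induced (x |: A)).
Proof.
move=> xA cS; pose B := [set y : induced A | edge x (val y)].
apply: (@homotopic_iso _ (add_vertex B)).
  apply: homotopic_extension; first exact: homotopic_refl.
  apply: contractible_iso cS _; apply: graph_iso_sym.
  apply: induced_induced; first exact: subsetIl.
  by move=> y; rewrite !inE (valP y).
apply: (@embedding_iso _ _ (fun o : add_vertex B => oapp val x o)).
- move=> [y|] [z|] //=; first by move/val_inj->.
    by move=> yx; case/negP: xA; rewrite -yx (valP y).
  by move=> yx; case/negP: xA; rewrite yx (valP z).
- by move=> [y|] [z|] //=; rewrite ?inE ?edge_irr // edge_sym.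
- by move=> [y|]; rewrite !inE ?eqxx //= (valP y) orbT.
- move=> y; rewrite !inE => /predU1P[->|yA]; first by exists None.
  by exists (Some (exist _ y yA)).
Qed.

(** * Suspensions *)

Section Suspension.
Variable G : sgraph.

Definition susp_edge : rel (G + bool) := fun u v =>
  match u, v with
  | inl x, inl y => edge x y
  | inr _, inr _ => false
  | _, _ => true
  end.

Fact susp_edge_sym : symmetric susp_edge.
Proof. by move=> [x|s] [y|t] //=; apply: edge_sym. Qed.

Fact susp_edge_irr : irreflexive susp_edge.
Proof. by move=> [x|s] //=; apply: edge_irr. Qed.

Definition susp : sgraph := SGraph susp_edge_sym susp_edge_irr.

Definition susp_set (A : {set G}) : {set susp} :=
  [set u | if u is inl x then x \in A else true].

End Suspension.

Lemma susp_induced (G : sgraph) (A : {set G}) :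
  graph_iso (susp (induced A)) (induced (susp_set A)).
Proof.
pose f (u : susp (induced A)) : susp G :=
  match u with inl x => inl (val x) | inr s => inr s end.
apply: (@embedding_iso _ _ f).
- by move=> [x|s] [y|t] //= [] // => [/val_inj|] ->.
- by move=> [x|s] [y|t].
- by move=> [x|s]; rewrite inE //= (valP x).
- move=> [x|s]; rewrite inE => xA; last by exists (inr s).
  by exists (inl (exist _ x xA)).
Qed.

Lemma susp_iso (G H : sgraph) : graph_iso G H -> graph_iso (susp G) (susp H).
Proof.
case=> f [g fK gK] fE.
exists (fun u : susp G =>
  match u with inl x => inl (f x) | inr s => inr s end : susp H).
  exists (fun u => match u with inl x => inl (g x) | inr s => inr s end).
    by move=> [x|s] //=; rewrite fK.
  by move=> [x|s] //=; rewrite gK.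
by move=> [x|s] [y|t] //=.
Qed.

Lemma susp_unit_sphere (G : sgraph) (x : G) :
  graph_iso (susp (unit_sphere x)) (unit_sphere (inl x : susp G)).
Proof.
apply: graph_iso_trans (susp_induced _) _; rewrite /unit_sphere.
suff -> : [set u : susp G | edge (inl x : susp G) u]
  = susp_set [set y | edge x y] by apply: graph_iso_refl.
by apply/setP => -[y|s]; rewrite !inE.
Qed.

Lemma susp_delete_vertex (G : sgraph) (x : G) :
  graph_iso (susp (delete_vertex x)) (delete_vertex (inl x : susp G)).
Proof.
apply: graph_iso_trans (susp_induced _) _; rewrite /delete_vertex.
suff -> : [set~ (inl x : susp G)] = susp_set [set~ x]
  by apply: graph_iso_refl.
by apply/setP => -[y|s]; rewrite !inE.
Qed.

Lemma susp_delete_pole (G : sgraph) (s : bool) :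
  contractible (delete_vertex (inr s : susp G)).
Proof.
apply: (@cone_contractible _ (inr (~~ s) : susp G)).
  by rewrite !inE; case: s.
by move=> [x|t] //; rewrite !inE; case: s t => -[].
Qed.

Lemma susp_contractible (G : sgraph) :
  contractible G -> contractible (susp G).
Proof.
elim=> {G} [G /eqP/fintype1P[x Gx]|G x _ IHs _ IHd].
  apply: contractible_iso (graph_iso_sym (induced_setT _)).
  apply: (@cone_contractible _ (inl x : susp G)); first by rewrite inE.
  by move=> [y|s] //= _; rewrite (Gx y) eqxx.
apply: (@contractible_step _ (inl x : susp G)).
  exact: contractible_iso (susp_unit_sphere x).
exact: contractible_iso (susp_delete_vertex x).
Qed.

Lemma susp_add_vertex (G : sgraph) (A : {set G}) :
  graph_iso (add_vertex (susp_set A)) (susp (add_vertex A)).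
Proof.
exists (fun o : add_vertex (susp_set A) =>
  match o with
  | None => inl None
  | Some (inl x) => inl (Some x)
  | Some (inr s) => inr s
  end : susp (add_vertex A)).
  exists (fun u => match u with
    | inl None => None | inl (Some x) => Some (inl x)
    | inr s => Some (inr s) end); first by move=> [[x|s]|].
  by move=> [[x|]|s].
by move=> [[x|s]|] [[y|t]|] //=; rewrite ?inE.
Qed.

Lemma susp_homotopic (G H : sgraph) :
  homotopic G H -> homotopic (susp G) (susp H).
Proof.
elim=> {H} [|H K _ GH HK|H A _ GH cA|H x _ GH cx].
- exact: homotopic_refl.
- exact: homotopic_iso (susp_iso HK).
- apply: homotopic_iso (susp_add_vertex A).
  apply: homotopic_extension => //.
  exact: contractible_iso (susp_contractible cA) (susp_induced A).
- apply: homotopic_iso (graph_iso_sym (susp_delete_vertex x)).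
  apply: homotopic_reduction => //.
  exact: contractible_iso (susp_contractible cx) (susp_unit_sphere x).
Qed.

Lemma iter_susp_homotopic (d : nat) (G H : sgraph) :
  homotopic G H -> homotopic (iter d susp G) (iter d susp H).
Proof. by move=> GH; elim: d => //= d; apply: susp_homotopic. Qed.

Lemma sphere_pred_iso (k : nat) (G H : sgraph) :
  graph_iso G H -> sphere_pred k G -> sphere_pred k H.
Proof.
elim: k G H => [|k IHk] G H [f fB fE] /=.
  by rewrite (bij_eq_card fB).
case=> Gs [x Gx]; split.
  case: (fB) => g fK gK y; apply: IHk (Gs (g y)).
  by rewrite -{2}(gK y); apply: unit_sphere_iso.
by exists (f x); apply: contractible_iso Gx _; apply: delete_vertex_iso.
Qed.

Lemma susp_pole_sphere (G : sgraph) (s : bool) :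
  graph_iso G (unit_sphere (inr s : susp G)).
Proof.
apply: (@embedding_iso _ _ (inl : G -> susp G)) => //=.
- by move=> x y [].
- by move=> x; rewrite inE.
- by move=> [y|t]; rewrite inE //=; exists y.
Qed.

(** The unit sphere of a pole is G, and that of a vertex of G is the suspension
    of its unit sphere in G. *)
Lemma susp_sphere_pred (k : nat) (G : sgraph) :
  sphere_pred k G -> sphere_pred k.+1 (susp G).
Proof.
elim: k G => [|k IHk] G GS; (split; last first).
- by exists (inr true); apply: susp_delete_pole.
- move=> [x|s]; last exact: sphere_pred_iso (susp_pole_sphere G s) GS.
  by case: (fintype0 x GS).
- by exists (inr true); apply: susp_delete_pole.
- move=> [x|s]; last exact: sphere_pred_iso (susp_pole_sphere G s) GS.
  apply: sphere_pred_iso (susp_unit_sphere x) _.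
  by apply: IHk; case: GS => + _; apply.
Qed.

Lemma iter_susp_sphere (d : nat) (G : sgraph) :
  is_sphere 0 G -> is_sphere d (iter d susp G).
Proof. by move=> G0; elim: d => //= d; apply: susp_sphere_pred. Qed.

(** * Suspension of a wedge *)

Section SplitPoles.
Variables (G H : sgraph) (a : G) (b : H).

Definition split_side (u : G + H) (k : option bool) : bool :=
  match k, u with
  | None, _ => true
  | Some false, inl _ => true
  | Some false, inr _ => false
  | Some true, inl x => x == a
  | Some true, inr _ => true
  end.

(** An ambient graph for the passage from the suspension of a wedge to the wedge
    of the suspensions.  The vertex b of H is left out of all the subgraphs
    considered, its role being played by a.  For each s there are
    three poles: (s, None) is joined to the whole wedge and to the other two,
    of which (s, Some false) is joined to G, and (s, Some true) to H and a. *)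
Definition split_edge : rel ((G + H) + (bool * option bool)) := fun u v =>
  match u, v with
  | inl (inl x), inl (inl y) => edge x y
  | inl (inr x), inl (inr y) => edge x y
  | inl (inl x), inl (inr y) | inl (inr y), inl (inl x) =>
      (x == a) && edge b y
  | inl w, inr (_, k) | inr (_, k), inl w => split_side w k
  | inr (s, k), inr (t, l) => (s == t) && ((k == None) != (l == None))
  end.

Fact split_edge_sym : symmetric split_edge.
Proof.
move=> [[x|x]|[s k]] [[y|y]|[t l]] //=; rewrite 1?edge_sym //.
by rewrite eq_sym (eq_sym (k == None)).
Qed.

Fact split_edge_irr : irreflexive split_edge.
Proof. by move=> [[x|x]|[s k]] /=; rewrite ?edge_irr ?eqxx ?andbF. Qed.

Definition split_graph : sgraph := SGraph split_edge_sym split_edge_irr.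

Definition with_poles (I : {set bool * option bool}) : {set split_graph} :=
  [set v | match v with
           | inl (inl _) => true
           | inl (inr y) => y != b
           | inr p => p \in I
           end].

Let pole s k : split_graph := inr (s, k).

Lemma eq_pole s t k l : (pole s k == pole t l) = (s == t) && (k == l).
Proof. by []. Qed.

Let poleE := (inE, xpair_eqE, eq_pole).

Lemma with_polesU1 p I :
  with_poles (p |: I) = (inr p : split_graph) |: with_poles I.
Proof. by apply/setP => -[[x|x]|q]; rewrite !inE. Qed.

Lemma with_polesD1 p I :
  with_poles (I :\ p) = with_poles I :\ (inr p : split_graph).
Proof. by apply/setP => -[[x|x]|q]; rewrite !inE. Qed.

(** The new poles may be added since their neighbours form cones with apex the
    old pole.  Then the unit sphere of the old pole consists of the wedge with
    the two new poles.  In it, all of H but the base point is dominated by the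
    second pole; once H is removed, that pole has a as its only neighbour; and
    without it there remains a cone over G. *)
Lemma split_pole (s : bool) (I : {set bool * option bool}) :
  (s, None) \in I -> (forall k, (s, Some k) \notin I) ->
  homotopic (induced (with_poles I))
    (induced (with_poles
      (((s, Some true) |: ((s, Some false) |: I)) :\ (s, None)))).
Proof.
move=> sI skI; set J := _ |: I; set K := _ |: J.
have extension k (L : {set bool * option bool}) :
    (s, None) \in L -> (s, Some k) \notin L ->
    homotopic (induced (with_poles L))
      (induced (with_poles ((s, Some k) |: L))).
  move=> sL skL; rewrite with_polesU1; apply: induced_extension.
    by rewrite inE.
  apply: (@cone_contractible _ (pole s None)).
    by rewrite !inE /= sL eqxx.
  move=> [[x|x]|[t [l|]]] //; rewrite !inE /= ?andbF //.
  by case: eqVneq => [<-|]; rewrite ?andbF ?eqxx.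
apply: homotopic_trans (extension false I sI (skI _)) _.
have sJ : (s, None) \in J by rewrite !inE sI orbT.
have skJ : (s, Some true) \notin J by rewrite !inE xpair_eqE eqxx /= skI.
apply: homotopic_trans (extension true J sJ skJ) _.
rewrite with_polesD1; apply: induced_reduction; first by rewrite !inE sI !orbT.
apply: (@dominated_contractible _ (pole s (Some true))
  [set v | if v is inl (inr _) then true else false]).
- by rewrite !inE /= ?poleE /= !eqxx ?orbT.
- by rewrite inE.
- by move=> [[x|x]|p]; rewrite inE.
- move=> [[x|x]|p] [[y|y]|[t [[]|]]] //; rewrite !inE /= ?poleE /= ?andbF //.
  + by move=> _ _ /andP[].
  + by move=> _ /andP[_ /andP[/eqP<-]] //; rewrite eqxx.
apply: (@dominated_contractible _ (inl (inl a) : split_graph)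
  [set pole s (Some true)]).
- by rewrite !inE.
- by rewrite inE.
- by move=> v /set1P->; rewrite /= eqxx.
- move=> v w /set1P->; case: w => [[y|y]|[t [l|]]] //;
    rewrite !inE /= ?poleE /= ?andbF //.
  by move=> _ /eqP->; rewrite eqxx.
apply: (@cone_contractible _ (pole s (Some false))).
  by rewrite !inE /= ?poleE /= !eqxx ?orbT.
move=> [[y|y]|[t [[]|]]] //; rewrite !inE /= ?poleE /= ?andbF //.
- by case: eqVneq => // st; rewrite andbF.
- by move=> /andP[_ /andP[_ /andP[/eqP<- _]]]; rewrite eqxx.
Qed.

Lemma susp_wedge :
  homotopic (susp (wedge a b)) (wedge (inl a : susp G) (inl b : susp H)).
Proof.
pose I := [set (false, None); (true, None)] : {set bool * option bool}.
have start : graph_iso (susp (wedge a b)) (induced (with_poles I)).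
  pose f (u : susp (wedge a b)) : split_graph :=
    match u with
    | inl (inl x) => inl (inl x)
    | inl (inr y) => inl (inr (val y))
    | inr s => pole s None
    end.
  apply: (@embedding_iso _ _ f).
  - by move=> [[x|x]|s] [[y|y]|t] //= [] // => [|/val_inj|] ->.
  - by move=> [[x|x]|s] [[y|y]|t] //=; rewrite andbF.
  - by move=> [[x|[x xb]]|s]; rewrite !inE //= !inE; case: s.
  - move=> [[y|y]|[s k]]; rewrite inE => yI.
    + by exists (inl (inl y)).
    + by exists (inl (inr (exist _ y yI))).
    + by exists (inr s); case: s k yI => -[k|]; rewrite !inE.
apply: homotopic_trans (iso_homotopic start) _.
apply: homotopic_trans (@split_pole false I _ _) _.
- by rewrite !inE.
- by move=> k; rewrite !inE.
set J := _ :\ _.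
apply: homotopic_trans (@split_pole true J _ _) _.
- by rewrite !inE.
- by move=> k; rewrite !inE.
set K := _ :\ _.
have KE s k : ((s, k) \in K) = (k != None).
  by rewrite !inE; case: s k => -[[]|].
apply/iso_homotopic/graph_iso_sym.
pose f (u : wedge (inl a : susp G) (inl b : susp H)) : split_graph :=
  match u with
  | inl (inl x) => inl (inl x)
  | inl (inr s) => pole s (Some false)
  | inr v => match val v with
             | inl y => inl (inr y)
             | inr s => pole s (Some true)
             end
  end.
apply: (@embedding_iso _ _ f).
- move=> [[x|s]|[[x|s] /= xb]] [[y|t]|[[y|t] /= yb]] //= [] //.
  + by move->.
  + by move->.
  + by move=> xy; congr inr; apply: val_inj; rewrite /= xy.
  + by move=> xy; congr inr; apply: val_inj; rewrite /= xy.
- by move=> [[x|s]|[[x|s] /= xb]] [[y|t]|[[y|t] /= yb]] //=;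
    rewrite ?andbF ?andbT.
- by move=> [[x|s]|[[x|s] xb]]; rewrite inE /= ?KE.
- move=> [[y|y]|[s [[]|]]]; rewrite inE ?KE // => yK.
  + by exists (inl (inl y)).
  + by exists (inr (exist _ (inl y : susp H) yK)).
  + by exists (inr (exist (fun v => v != (inl b : susp H)) (inr s) isT)).
  + by exists (inl (inr s)).
Qed.

End SplitPoles.

Lemma iter_susp_wedge (d : nat) (G H : sgraph) (a : G) (b : H) :
  exists (a' : iter d susp G) (b' : iter d susp H),
    homotopic (iter d susp (wedge a b)) (wedge a' b').
Proof.
elim: d => [|d [a' [b' IHd]]]; first by exists a, b; apply: homotopic_refl.
exists (inl a'), (inl b').
exact: homotopic_trans (susp_homotopic IHd) (susp_wedge a' b').
Qed.

(** * Complements of cycles *)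

Definition cocycle (n : nat) : sgraph := complement (cycle_graph n).

Lemma cocycle_edgeE n (i j : 'I_n) : 1 < n ->
  @edge (cocycle n) i j =
  [&& i != j :> nat, i.+1 != j, j.+1 != i,
      ~~ ((i == 0 :> nat) && (j == n.-1 :> nat))
    & ~~ ((j == 0 :> nat) && (i == n.-1 :> nat))].
Proof.
move=> n_gt1; rewrite /= /complement_edge /= /cycle_edge -!val_eqE /=.
have modS (k : 'I_n) : k.+1 %% n = if k.+1 == n then 0 else k.+1.
  have := ltn_ord k; case: eqP => [->|kn] k_lt; first by rewrite modnn.
  by rewrite modn_small //; lia.
rewrite !modS; have := ltn_ord i; have := ltn_ord j.
by case: ifP; case: ifP; lia.
Qed.

Lemma cocycle2_edgeless (i j : cocycle 2) : edge i j = false.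
Proof. by rewrite cocycle_edgeE //; case: i j => -[|[|i]] // ? [[|[|j]]]. Qed.

Lemma cocycle_graph_iso n : graph_iso (cocycle n) (cocycle_graph n).
Proof.
rewrite /cocycle_graph; case: eqP => [->|_]; last exact: graph_iso_refl.
exact: (edgeless_iso cocycle2_edgeless).
Qed.

(** Adding to the complement of C_(n+3) a vertex whose non-neighbours are 0 and
    n - 2 prepares the shorter cycle 0, ..., n - 2 and the new vertex.  The
    vertices n - 1 and n + 2 can then be removed, and the non-adjacent vertices
    n and n + 1 become the poles of a suspension. *)
Lemma cocycle_add3 n : 1 < n ->
  homotopic (cocycle n.+3) (susp (cocycle n)).
Proof.
move=> n_gt1.
have vertex k : k < n.+3 -> exists i : 'I_n.+3, i = k :> nat.
  by move=> kn; exists (Ordinal kn).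
have [|a aE] := vertex n.-1; first by lia.
have [|x xE] := vertex n; first by lia.
have [|y yE] := vertex n.+1; first by lia.
have [|z zE] := vertex n.+2; first by lia.
have eE (i j : 'I_n.+3) := @cocycle_edgeE n.+3 i j isT.
pose A := [set i : cocycle n.+3 | (i != 0 :> nat) && (i != n.-2 :> nat)].
pose K := add_vertex A.
have eN (i : 'I_n.+3) :
    @edge K None (Some i) = (i != 0 :> nat) && (i != n.-2 :> nat).
  by rewrite /= inE.
have eN' (i : 'I_n.+3) : @edge K (Some i) None = @edge K None (Some i) by [].
have eS (i j : 'I_n.+3) :
  @edge K (Some i) (Some j) = @edge (cocycle n.+3) i j by [].
have eqS (i j : 'I_n.+3) : (Some i == Some j :> K) = (i == j :> nat) by [].
have addA : homotopic (cocycle n.+3) K.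
  apply: homotopic_extension; first exact: homotopic_refl.
  (* Within A the only non-neighbour of z is n + 1, which is not a neighbour
     of n either, so that z dominates n; and n is the only non-neighbour of
     n - 1. *)
  apply: (@dominated_contractible (cocycle n.+3) z [set x]).
  - by rewrite inE; lia.
  - by rewrite inE -val_eqE /=; lia.
  - by move=> v /set1P->; rewrite eE; lia.
  - move=> v w /set1P->; rewrite inE !eE -!val_eqE /=.
    by have := ltn_ord w; lia.
  apply: (@cone_contractible (cocycle n.+3) a).
    by rewrite !inE -!val_eqE /=; lia.
  move=> w; rewrite !inE eE -!val_eqE /=.
  by have := ltn_ord w; lia.
apply: homotopic_trans addA _.
apply: homotopic_trans (iso_homotopic (induced_setT _)) _.
have del_a : homotopic (induced [set: K]) (induced [set~ (Some a : K)]).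
  rewrite -setTD; apply: induced_reduction; first by rewrite inE.
  (* Since n is not adjacent to a, the only non-neighbour of y in the unit
     sphere of a is n + 2, which is not a neighbour of 0 either; and n - 2 is
     not adjacent to a, so that the new vertex is an apex once 0 is removed. *)
  rewrite setTI; apply: (@dominated_contractible _ (Some y : K)
    [set (Some ord0 : K)]).
  - by rewrite inE eS eE; lia.
  - by rewrite inE eqS /=; lia.
  - by move=> v /set1P->; rewrite eS eE /=; lia.
  - move=> v [w|] /set1P->; rewrite inE ?eS ?eN' ?eN ?eE ?eqS //=.
    by have := ltn_ord w; lia.
  apply: (@cone_contractible _ (None : K)).
    by rewrite !inE /= ?inE; lia.
  move=> [w|] //; rewrite 3!inE eqS eS eN eE /=.
  by have := ltn_ord w; lia.
apply: homotopic_trans del_a _.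
apply: homotopic_trans (@induced_reduction _ _ (Some z : K) _ _) _.
- by rewrite !inE eqS; lia.
- (* Once a is removed, the only non-neighbour of n is n + 1, which lies
     outside the unit sphere of n + 2. *)
  apply: (@cone_contractible _ (Some x : K)).
    by rewrite !inE eqS eS eE; lia.
  move=> [w|]; last by rewrite eN' eN; lia.
  rewrite !inE !eqS !eS !eE.
  by have := ltn_ord w; lia.
pose f (u : susp (cocycle n)) : K :=
  match u with
  | inl i => if i == n.-1 :> nat then None
             else Some (widen_ord (leq_addl 3 n) i)
  | inr s => Some (if s then y else x)
  end.
have fE (i : cocycle n) : f (inl i) =
  if i == n.-1 :> nat then None else Some (widen_ord (leq_addl 3 n) i) by [].
apply/iso_homotopic/graph_iso_sym; apply: (@embedding_iso _ _ f).
- move=> [i|s] [j|t]; rewrite ?fE.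
  + case: eqP => [ia|_]; case: eqP => [ja|_] //.
      by move=> _; congr inl; apply: ord_inj; rewrite ia ja.
    by case=> ij; congr inl; apply: ord_inj.
  + case: eqP => // _ [/(congr1 val)/=]; have := ltn_ord i.
    by case: t; lia.
  + case: eqP => // _ [/(congr1 val)/=]; have := ltn_ord j.
    by case: s; lia.
  + by case: s t => -[] // [/(congr1 val)/=]; lia.
- move=> [i|s] [j|t]; rewrite ?fE.
  + have := ltn_ord i; have := ltn_ord j.
    change (edge (inl i : susp (cocycle n)) (inl j)) with (edge i j).
    rewrite (cocycle_edgeE _ _ n_gt1).
    case: eqP => ia; case: eqP => ja; rewrite ?eN' ?eN ?eS ?eE /=; lia.
  + have := ltn_ord i.
    by case: eqP => ia; case: t; rewrite ?eN ?eS ?eE /=; lia.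
  + have := ltn_ord j.
    by case: eqP => ia; case: s; rewrite ?eN' ?eN ?eS ?eE /=; lia.
  + by rewrite eS eE; case: s t => -[] /=; lia.
- move=> [i|s]; rewrite ?fE; last first.
    by rewrite !inE !eqS; case: s; lia.
  by have := ltn_ord i; case: eqP; rewrite !inE ?eqS /=; lia.
- move=> [i|]; last first.
    have n1_lt : n.-1 < n by lia.
    by exists (inl (Ordinal n1_lt)); rewrite fE eqxx.
  rewrite !inE !eqS => /andP[iz ia].
  have i_lt := ltn_ord i.
  have [ix|ix] := eqVneq (i : nat) n.
    by exists (inr false); congr Some; apply: ord_inj; rewrite /= xE ix.
  have [iy|iy] := eqVneq (i : nat) n.+1.
    by exists (inr true); congr Some; apply: ord_inj; rewrite /= yE iy.
  have i_ltn : i < n by lia.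
  exists (inl (Ordinal i_ltn)); rewrite fE /= ifN; last by lia.
  by congr Some; apply: ord_inj.
Qed.

Lemma cocycle_iter_susp (d m : nat) : 1 < m ->
  homotopic (cocycle (3 * d + m)) (iter d susp (cocycle m)).
Proof.
move=> m_gt1; elim: d => [|d IHd].
  by rewrite muln0; apply: homotopic_refl.
have -> : 3 * d.+1 + m = (3 * d + m).+3 by lia.
have dm_gt1 : 1 < 3 * d + m by lia.
exact: homotopic_trans (cocycle_add3 dm_gt1) (susp_homotopic IHd).
Qed.

Lemma cocycle2_sphere : is_sphere 0 (cocycle 2).
Proof.
split=> [x|].
  by apply: eq_card0 => y; have := valP y; rewrite inE cocycle2_edgeless.
exists (ord0 : 'I_2); apply: contractible_K1.
by rewrite card_sig -[LHS]/#|[set~ (ord0 : 'I_2)]| cardsC1 card_ord.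
Qed.

Lemma cocycle3_wedge :
  graph_iso (cocycle 3) (wedge (ord0 : cocycle 2) (ord0 : cocycle 2)).
Proof.
apply: edgeless_iso.
- move=> i j; rewrite cocycle_edgeE //.
  by case: i j => -[|[|[|i]]] // ? [[|[|[|j]]]].
- have e0 (x y : cycle_graph 2) : complement_edge x y = false
    := cocycle2_edgeless x y.
  by move=> [x|x] [y|y]; rewrite /= e0 ?andbF.
- change (#|'I_3| = #|{: 'I_2 + {y : 'I_2 | y != ord0}}|).
  by rewrite card_sum card_sig -[X in _ = _ + X]/#|predC1 _| cardC1 !card_ord.
Qed.

Lemma cocycle4_reduction : homotopic (cocycle 4) (cocycle 2).
Proof.
have vertex k : k < 4 -> exists i : 'I_4, i = k :> nat.
  by move=> k4; exists (Ordinal k4).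
have [//|i0 i0E] := vertex 0; have [//|i1 i1E] := vertex 1.
have [//|i2 i2E] := vertex 2; have [//|i3 i3E] := vertex 3.
have eE (i j : 'I_4) := @cocycle_edgeE 4 i j isT.
apply: homotopic_trans (iso_homotopic (induced_setT _)) _.
(* The only neighbour of i is j. *)
have del (i j : 'I_4) (A : {set cocycle 4}) :
    1 < i -> i \in A -> j \in A -> j + 2 = i ->
    homotopic (induced A) (induced (A :\ i)).
  move=> i_gt1 iA jA ij; apply: induced_reduction => //.
  apply: (@cone_contractible (cocycle 4) j).
    by rewrite !inE jA eE; lia.
  move=> k; rewrite !inE !eE -val_eqE /=.
  by have := ltn_ord i; have := ltn_ord k; lia.
apply: homotopic_trans (del i2 i0 _ _ _ _ _) _; rewrite ?inE //; try lia.
apply: homotopic_trans (del i3 i1 _ _ _ _ _) _;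
  rewrite ?inE -?val_eqE //=; try lia.
apply: iso_homotopic; apply: edgeless_iso => [[i iA] [j jA]||].
- change (@edge (cocycle 4) i j = false); move: iA jA.
  rewrite eE !inE -!val_eqE /=.
  by have := ltn_ord i; have := ltn_ord j; lia.
- exact: cocycle2_edgeless.
- rewrite card_sig card_ord -[LHS]/#|[set: 'I_4] :\ i2 :\ i3|.
  have := cardsD1 i3 ([set: 'I_4] :\ i2).
  have := cardsD1 i2 [set: 'I_4].
  by rewrite cardsT card_ord !inE -!val_eqE /= i2E i3E /= !add1n => -[<-] [<-].
Qed.

Theorem theorem2 (d : nat) :
  (exists (S1 S2 : sgraph) (a : S1) (b : S2),
     [/\ is_sphere d S1, is_sphere d S2
       & homotopic (cocycle_graph (3 * d + 3)) (wedge a b)]) /\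
  (exists S : sgraph,
     is_sphere d S /\ homotopic (cocycle_graph (3 * d + 2)) S) /\
  (exists S : sgraph,
     is_sphere d S /\ homotopic (cocycle_graph (3 * d + 4)) S).
Proof.
have start m : 1 < m ->
    homotopic (cocycle_graph (3 * d + m)) (iter d susp (cocycle m)).
  move=> m_gt1; apply: homotopic_trans (cocycle_iter_susp d m_gt1).
  exact/iso_homotopic/graph_iso_sym/cocycle_graph_iso.
have sphere_d := iter_susp_sphere d cocycle2_sphere.
split; last split.
- have [a [b wedge_ab]] :=
    iter_susp_wedge d (ord0 : cocycle 2) (ord0 : cocycle 2).
  exists _, _, a, b; split=> //.
  apply: homotopic_trans (start 3 isT) _.
  apply: homotopic_trans wedge_ab.
  exact/iter_susp_homotopic/iso_homotopic/cocycle3_wedge.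
- by exists (iter d susp (cocycle 2)); split=> //; apply: start.
- exists (iter d susp (cocycle 2)); split=> //.
  apply: homotopic_trans (start 4 isT) _.
  exact/iter_susp_homotopic/cocycle4_reduction.
Qed.
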